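(* Let $\psi:U_Z\to\mathbb{R}$ be an increasing convex functional such that $\lim_{z\to+\infty}\psi(n(Z-z)^+)=\psi(0)$ for every $n\in\mathbb{N}$. Then the following are equivalent: (i) $\psi(X)=\max_{\mu\in ca^+_Z}(\langle X,\mu\rangle-\psi^*_{C_Z}(\mu))$ for all $X\in U_Z$; (ii) $\psi(X_n)\downarrow\psi(X)$ for every $X\in U_Z$ and every sequence $(X_n)$ in $C_Z$ decreasing pointwise to $X$; (iii) $\psi(X)=\inf_{Y\in C_Z,\,Y\ge X}\psi(Y)$ for all $X\in U_Z$; (iv) $\psi^*_{C_Z}(\mu)=\psi^*_{U_Z}(\mu)$ for all $\mu\in ca^+_Z$.
   Context: Fix integers $J\ge0$, $T\ge1$. $\Omega$ is a non-empty subset of $((0,\infty)\times\mathbb{R}^J)^T$ with the Euclidean metric. $Z:\Omega\to[1,\infty)$ is continuous with $\{\omega\in\Omega:Z(\omega)\le z\}$ compact for every $z\in\mathbb{R}_+$. $U_Z$ (resp. $C_Z$) is the set of upper semicontinuous (resp. continuous) functions $X:\Omega\to\mathbb{R}$ with $X/Z$ bounded; note $(Z-z)^+\in C_Z\subseteq U_Z$. $ca^+_Z$ is the set of (nonnegative) Borel measures $\mu$ on $\Omega$ with $\int Z\,d\mu<\infty$; $\langle X,\mu\rangle=\int X\,d\mu$. $\psi$ increasing means $\psi(X)\ge\psi(Y)$ whenever $X\ge Y$. $\psi^*_{C_Z}(\mu)=\sup_{X\in C_Z}(\langle X,\mu\rangle-\psi(X))$ and $\psi^*_{U_Z}(\mu)=\sup_{X\in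 U_Z}(\langle X,\mu\rangle-\psi(X))$; $\downarrow$ denotes monotone decreasing convergence. *)

(* Defs.v *)
From HB Require Import structures.
From mathcomp Require Import all_boot all_order all_algebra.
From mathcomp Require Import all_classical all_reals all_analysis.
Set Implicit Arguments. Unset Strict Implicit. Unset Printing Implicit Defensive.
Import Order.TTheory GRing.Theory Num.Theory.
Import numFieldNormedType.Exports.
Local Open Scope classical_set_scope.
Local Open Scope ring_scope.

(* Ambient space ((0,oo) x R^J)^T is represented by T x (J+1) real matrices:
   row t = (s_t, x_t) with s_t the (0,oo)-component (column ord0). *)
Definition ambient (R : realType) (T J : nat) := 'M[R]_(T, J.+1).

Definition pos_first_col (R : realType) (T J : nat) : set (ambient R T J) :=
  [set x | forall t : 'I_T, 0 < x t ord0].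

(* Omega, as a subspace (sigma type with the subspace topology); the point
   x0 witnesses non-emptiness and is only used to equip the type with
   the pointedType structure required by the Borel sigma-algebra. *)
Definition Omega (R : realType) (T J : nat) (Om : set (ambient R T J))
  (x0 : set_type Om) : Type := set_type Om.

Section OmegaInstances.
Context (R : realType) (T J : nat) (Om : set (ambient R T J)) (x0 : set_type Om).
HB.instance Definition _ := Topological.copy (Omega x0) (set_type Om).
HB.instance Definition _ := isPointed.Build (Omega x0) x0.
End OmegaInstances.

Definition Borel (R : realType) (T J : nat) (Om : set (ambient R T J))
  (x0 : set_type Om) := g_sigma_algebraType (@open (Omega x0)).

Section Defs.
Context (R : realType) (T J : nat) (Om : set (ambient R T J)) (x0 : set_type Om).
Local Notation W := (Omega x0).

Definition upper_semicontinuous (X : W -> R) : Prop :=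
  forall w (a : R), X w < a -> exists2 V, nbhs w V & forall y, V y -> X y < a.

Definition ratio_bounded (Z X : W -> R) : Prop :=
  exists c : R, forall w, `|X w / Z w| <= c.

Definition UZ (Z : W -> R) : set (W -> R) :=
  [set X | upper_semicontinuous X /\ ratio_bounded Z X].
Definition CZ (Z : W -> R) : set (W -> R) :=
  [set X | continuous X /\ ratio_bounded Z X].

Definition caZ (Z : W -> R) (mu : {measure set (Borel x0) -> \bar R}) : Prop :=
  (\int[mu]_w (Z w)%:E < +oo)%E.

Definition pairing (X : W -> R) (mu : {measure set (Borel x0) -> \bar R}) : \bar R :=
  (\int[mu]_w (X w)%:E)%E.

Definition conj_on (S : set (W -> R)) (psi : (W -> R) -> R)
  (mu : {measure set (Borel x0) -> \bar R}) : \bar R :=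
  ereal_sup [set (pairing X mu - (psi X)%:E)%E | X in S].

Definition increasing_on (S : set (W -> R)) (psi : (W -> R) -> R) : Prop :=
  forall X Y, S X -> S Y -> (forall w, Y w <= X w) -> psi Y <= psi X.

Definition convex_on (S : set (W -> R)) (psi : (W -> R) -> R) : Prop :=
  forall X Y (l : R), S X -> S Y -> 0 <= l <= 1 ->
    psi (fun w => l * X w + (1 - l) * Y w) <= l * psi X + (1 - l) * psi Y.
End Defs.

(* Main.v *)
Require Import Defs.
From HB Require Import structures.
From mathcomp Require Import all_boot all_order all_algebra.
From mathcomp Require Import all_classical all_reals all_analysis.
From mathcomp Require Import measurable_realfun ring lra.
Import Order.TTheory GRing.Theory Num.Theory.
Import numFieldNormedType.Exports.
Set Implicit Arguments. Unset Strict Implicit. Unset Printing Implicit Defensive.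
Local Open Scope classical_set_scope.
Local Open Scope ring_scope.

(* Fix X in U_Z. The convex function V |-> psi (X + V) - psi X on C_Z has, by
   Hahn-Banach, a linear minorant L, which is positive because psi is increasing.
   The growth condition on psi gives L ((Z - z)^+) -> 0, so with Dini's theorem on
   the compact sets {Z <= z} the functional L is continuous along sequences
   decreasing to 0, and the Daniell construction represents it by a measure mu in
   ca_Z^+. If Y >= X and W lie in C_Z, then
     <W - Y, mu> <= psi (X + W - Y) - psi X <= psi W - psi X,
   and letting Y decrease to X gives psi X <= <X, mu> - psi*_C mu for every X in
   U_Z. Hence (i) and (iv) both amount to the reverse inequality, which (iii)
   also implies.

   The same argument for the limit of V |-> psi (X_n + V) - inf_k psi X_k along a
   decreasing sequence X_n yields one mu with
     inf_k psi X_k <= <X, mu> - psi*_C mu,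
   which proves (i) -> (ii) without any compactness of sets of measures. *)

(** * Continuity and order preliminaries *)

Section continuous_real_functions.
Context {R : realType} {W : topologicalType}.
Implicit Types f g : W -> R.

Lemma continuous_fcst (c : R) : continuous (fun _ : W => c).
Proof. by move=> x; exact: cvg_cst. Qed.

Lemma continuous_fadd f g : continuous f -> continuous g ->
  continuous (fun x => f x + g x).
Proof. by move=> cf cg x; apply: cvgD; [exact: cf|exact: cg]. Qed.

Lemma continuous_fmul f g : continuous f -> continuous g ->
  continuous (fun x => f x * g x).
Proof. by move=> cf cg x; apply: cvgM; [exact: cf|exact: cg]. Qed.

Lemma continuous_fsub f g : continuous f -> continuous g ->
  continuous (fun x => f x - g x).
Proof. by move=> cf cg x; apply: cvgB; [exact: cf|exact: cg]. Qed.

Lemma continuous_fmin f g : continuous f -> continuous g ->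
  continuous (fun x => Num.min (f x) (g x)).
Proof. by move=> cf cg x; exact: (continuous_min (cf x) (cg x)). Qed.

Lemma continuous_fmax f g : continuous f -> continuous g ->
  continuous (fun x => Num.max (f x) (g x)).
Proof. by move=> cf cg x; exact: (continuous_max (cf x) (cg x)). Qed.

End continuous_real_functions.

Section order_facts.
Context {R : realType}.

Lemma decreasing_le (u : nat -> R) : (forall n, u n.+1 <= u n) ->
  forall n m, (n <= m)%N -> u m <= u n.
Proof. by move=> uS n m; have /nonincreasing_seqP := uS; exact. Qed.

Lemma decreasing_cvg_ge (u : nat -> R) (a : R) : (forall n, u n.+1 <= u n) ->
  u n @[n --> \oo] --> a -> forall n, a <= u n.
Proof.
move=> uS ua n; rewrite -(cvg_lim _ ua)//.
by apply: nonincreasing_cvgn_ge; [exact/nonincreasing_seqP|exact: cvgP ua].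
Qed.

(** Exchanges value and conjugate in the Fenchel inequality. The conjugate [c] may be infinite, so
    only [x] is taken finite. *)
Lemma leeB_swap (x c : \bar R) (r : R) : x \is a fin_num ->
  ((x - r%:E <= c) = (x - c <= r%:E))%E.
Proof.
move=> xfin; rewrite -(fineK xfin); case: c => [c| |] /=.
- by rewrite -!EFinB !lee_fin lerBlDr lerBlDl addrC.
- by rewrite leey leNye.
- by rewrite leeNy_eq leye_eq.
Qed.

End order_facts.

(** * Hahn-Banach for convex functions *)

Section inf_facts.
Context {R : realType}.

(** Choosing both elements within [e] of their infima costs [l * e + (1 - l) * e = e]. This is how
    convexity passes to infima of families. *)
Lemma lb_le_inf_convex (A B : set R) (b l : R) : A !=set0 -> B !=set0 ->
  0 <= l <= 1 -> (forall x y, A x -> B y -> b <= l * x + (1 - l) * y) ->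
  has_lbound A -> has_lbound B -> b <= l * inf A + (1 - l) * inf B.
Proof.
move=> A0 B0 /andP[l0 l1] H lA lB; apply/ler_addgt0Pr => e e0.
have [x Ax xA] := inf_adherent e0 (conj A0 lA).
have [y By yB] := inf_adherent e0 (conj B0 lB).
apply: (le_trans (H _ _ Ax By)).
have : l * x <= l * (inf A + e) by rewrite ler_wpM2l// ltW.
have : (1 - l) * y <= (1 - l) * (inf B + e) by rewrite ler_wpM2l ?subr_ge0// ltW.
lra.
Qed.

End inf_facts.

Section hahn_banach.
Context {R : realType} {V : lmodType R}.
Variable E : set V.
Hypothesis ED : forall x y, E x -> E y -> E (x + y).
Hypothesis EZ : forall (a : R) x, E x -> E (a *: x).

Definition convex_in (q : V -> R) := forall x y (l : R), E x -> E y ->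
  0 <= l <= 1 -> q (l *: x + (1 - l) *: y) <= l * q x + (1 - l) * q y.

Lemma convex_in_mid q x y : convex_in q -> E x -> E y ->
  q (2^-1 *: (x + y)) <= 2^-1 * (q x + q y).
Proof.
move=> cq Ex Ey; rewrite scalerDr mulrDr.
have h : 1 - 2^-1 = 2^-1 :> R by field.
by have := cq x y 2^-1 Ex Ey; rewrite h; apply; rewrite invr_ge0 ler0n /=; lra.
Qed.

Lemma convex_in_opp_ge q x : convex_in q -> q 0 = 0 -> E x -> - q (- x) <= q x.
Proof.
move=> cq q0 Ex; have ENx : E (- x) by rewrite -scaleN1r; exact: EZ.
have := convex_in_mid cq Ex ENx; rewrite subrr scaler0 q0; lra.
Qed.

(** Since 0 lies between [- u *: y] and [t *: y], every slope on the negative side is at most every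
    slope on the positive side. The infimum of the latter is a subgradient at 0 along the line
    through [y]. *)
Lemma convex_in_slope q y : convex_in q -> q 0 = 0 -> E y ->
  exists s : R, forall t, t * s <= q (t *: y).
Proof.
move=> cq q0 Ey; pose S := [set q (t *: y) / t | t in [set t : R | 0 < t]].
have key (t u : R) : 0 < t -> 0 < u -> - q (- u *: y) / u <= q (t *: y) / t.
  move=> t0 u0; have tu0 : 0 < t + u by rewrite addr_gt0.
  have tu : t + u != 0 by rewrite gt_eqF.
  (* The weight [u / (t + u)] is the one for which the convex combination is 0. *)
  have := cq (t *: y) (- u *: y) (u / (t + u)) (EZ t Ey) (EZ (- u) Ey).
  rewrite !scalerA -scalerDl.
  have -> : u / (t + u) * t + (1 - u / (t + u)) * - u = 0 by field.
  rewrite scale0r q0 => H.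
  have {H}H : 0 <= u / (t + u) * q (t *: y) + (1 - u / (t + u)) * q (- u *: y).
    apply: H; apply/andP; split; first by rewrite divr_ge0// ltW.
    by rewrite ler_pdivrMr// mul1r lerDr ltW.
  rewrite -subr_ge0.
  have -> : q (t *: y) / t - - q (- u *: y) / u = (t + u) / (t * u) *
      (u / (t + u) * q (t *: y) + (1 - u / (t + u)) * q (- u *: y)).
    by field; rewrite ?tu ?gt_eqF.
  apply: mulr_ge0 => //; apply: divr_ge0; first exact: ltW.
  by apply: mulr_ge0; exact: ltW.
have S0 : S !=set0 by exists (q (1 *: y) / 1); exists 1 => //=.
have lS : has_lbound S.
  by exists (- q (- 1 *: y) / 1) => _ [t /= t0 <-]; exact: key.
exists (inf S) => t; have [t0|t0|->] := ltgtP t 0; last first.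
- by rewrite mul0r scale0r q0.
- rewrite mulrC -ler_pdivlMr//; apply: ge_inf => //.
  by exists t.
- have Nt0 : 0 < - t by rewrite oppr_gt0.
  rewrite -[leLHS]opprK -mulNr lerNl mulrC -ler_pdivrMr// -[t in q (t *: _)]opprK.
  by apply: lb_le_inf => // _ [u /= u0 <-]; exact: key.
Qed.

(** With [s] a slope along [y], the function [r x = inf_t (q (x + t *: y) - t * s)] is convex, lies
    below [q] and vanishes at 0. Minimality gives [q <= r], which forces [q] to be affine of slope
    [s] in the direction [y]. *)
Lemma minimal_convex_in_linear (q : V -> R) : convex_in q -> q 0 = 0 ->
  (forall r, convex_in r -> r 0 = 0 -> (forall x, E x -> r x <= q x) ->
    forall x, E x -> q x <= r x) ->
  forall (a : R) x y, E x -> E y -> q (a *: x + y) = a * q x + q y.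
Proof.
move=> cq q0 qmin.
suff key y : E y -> exists s : R, forall t x, E x -> q (x + t *: y) = q x + t * s.
  move=> a x y Ex Ey; have [s sE] := key x Ex.
  have E0 : E 0 by rewrite -(scale0r y); exact: EZ.
  have -> : q x = s by rewrite -[x]scale1r -[_ *: x]add0r sE// q0 add0r mul1r.
  by rewrite addrC sE// addrC.
move=> Ey; have [s sP] := convex_in_slope cq q0 Ey; exists s.
(* The opposite inequality is this one at the point [x + t *: y] with parameter [- t]. *)
suff le t x : E x -> q x + t * s <= q (x + t *: y).
  move=> t x Ex; apply/eqP; rewrite eq_le le// andbT -lerBlDr -mulNr.
  by rewrite (le_trans (le _ _ _))// ?scaleNr ?addrK//; exact: ED (EZ _ Ey).
move: t x; pose S x := [set q (x + t *: y) - t * s | t in [set: R]].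
have S0 x : S x !=set0 by exists (q (x + 0 *: y) - 0 * s); exists 0.
have lS x : E x -> has_lbound (S x).
  move=> Ex; exists (- q (- x)) => _ [t _ <-].
  have ENx : E (- x) by rewrite -scaleN1r; exact: EZ.
  (* The midpoint of [x + t *: y] and [- x] is [(t / 2) *: y], where the slope bound applies. *)
  have := convex_in_mid cq (ED Ex (EZ t Ey)) ENx.
  rewrite [x + _]addrC addrK scalerA; have := sP (2^-1 * t); lra.
pose r x := inf (S x).
have rle x t : E x -> r x <= q (x + t *: y) - t * s.
  by move=> Ex; apply: ge_inf; [exact: lS|exists t].
have rq x : E x -> r x <= q x.
  by move=> Ex; rewrite (le_trans (rle x 0 Ex))// scale0r addr0 mul0r subr0.
have E0 : E 0 by rewrite -(scale0r y); exact: EZ.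
have r0 : r 0 = 0.
  apply/eqP; rewrite eq_le; apply/andP; split; first by rewrite -[leRHS]q0 rq.
  by apply: lb_le_inf => // _ [t _ <-]; rewrite add0r subr_ge0.
have cr : convex_in r.
  move=> x z l Ex Ez l01; apply: lb_le_inf_convex => //; [|exact: lS..].
  move=> _ _ [t _ <-] [u _ <-].
  have Exz : E (l *: x + (1 - l) *: z) by apply: ED; exact: EZ.
  apply: (le_trans (rle _ (l * t + (1 - l) * u) Exz)).
  have := cq _ _ _ (ED Ex (EZ t Ey)) (ED Ez (EZ u Ey)) l01.
  rewrite !scalerDr !scalerA addrACA -scalerDl; lra.
move=> t x Ex; have := le_trans (qmin r cr r0 rq x Ex) (rle x t Ex); lra.
Qed.

(** Instead of extending a functional step by step, Zorn's lemma yields a minimal convex function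
    below [p] vanishing at 0, and minimality makes it linear. The order [rel] is reversed, so that
    maximal means pointwise minimal. A chain is bounded by its pointwise infimum, finite because
    each member is at least [- p (- x)]. *)
Theorem hahn_banach_convex (p : V -> R) : convex_in p -> p 0 = 0 ->
  exists f : V -> R, (forall (a : R) x y, E x -> E y ->
    f (a *: x + y) = a * f x + f y) /\ (forall x, E x -> f x <= p x).
Proof.
move=> cp p0; pose P q := [/\ convex_in q, q 0 = 0 & forall x, E x -> q x <= p x].
pose T := {q : V -> R | P q}.
pose rel (q r : T) := `[< forall x, E x -> sval r x <= sval q x >].
have Pp : P p by split.
have [|||q qmin] := @ZL_preorder T (exist _ p Pp) rel.
- by move=> q; apply/asboolP.
- move=> q r s /asboolP qr /asboolP rs; apply/asboolP => x Ex.
  by rewrite (le_trans (rs _ Ex))// qr.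
- move=> A totA; have [->|/set0P[q0 Aq0]] := eqVneq A set0.
    by exists (exist _ p Pp).
  pose S x := [set sval q x | q in A].
  have S0 x : S x !=set0 by exists (sval q0 x); exists q0.
  have lS x : E x -> has_lbound (S x).
    move=> Ex; have ENx : E (- x) by rewrite -scaleN1r; exact: EZ.
    exists (- p (- x)) => _ [q Aq <-]; case: (q) => /= q' [cq' q'0 q'p].
    by rewrite (le_trans _ (convex_in_opp_ge cq' q'0 Ex))// lerN2 q'p.
  pose r x := inf (S x).
  have rle q x : A q -> E x -> r x <= sval q x.
    by move=> Aq Ex; apply: ge_inf; [exact: lS|exists q].
  have Pr : P r.
    split.
    + move=> x y l Ex Ey /[dup] l01 /andP[l0 l1].
      apply: lb_le_inf_convex => //; [|exact: lS..].
      have Exy : E (l *: x + (1 - l) *: y) by apply: ED; exact: EZ.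
      have main q a b : A q -> sval q x <= a -> sval q y <= b ->
          r (l *: x + (1 - l) *: y) <= l * a + (1 - l) * b.
        move=> Aq qa qb; apply: (le_trans (rle q _ Aq Exy)).
        case: (q) qa qb => /= q' [cq' _ _] qa qb.
        apply: (le_trans (cq' _ _ _ Ex Ey l01)).
        by rewrite lerD// ler_wpM2l// subr_ge0.
      move=> _ _ [q1 Aq1 <-] [q2 Aq2 <-].
      (* The smaller of the two comparable members serves at both points, and its convexity is
         enough. *)
      have [/asboolP q12|/asboolP q21] := totA _ _ Aq1 Aq2.
      * by apply: (main q2) => //; exact: q12.
      * by apply: (main q1) => //; exact: q21.
    + rewrite /r (_ : S 0 = [set 0]) ?inf1//; apply/seteqP; split => [_ [q _ <-]|_ ->].
        by case: (q) => ? [].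
      by exists q0 => //; case: (q0) => ? [].
    + move=> x Ex; apply: (le_trans (rle _ _ Aq0 Ex)).
      by have [_ _] := svalP q0; apply.
  by exists (exist _ r Pr) => q Aq; apply/asboolP => x Ex; exact: rle.
have [cq q0 qp] := svalP q; exists (sval q); split => //.
apply: minimal_convex_in_linear => // r cr r0 rq.
have Pr : P r by split => // x Ex; rewrite (le_trans (rq _ Ex))// qp.
have /asboolP := qmin (exist _ r Pr) (asboolT rq).
by [].
Qed.

End hahn_banach.

(** * Lipschitz regularization *)

Section lipschitz_regularization.
Context {R : realType} {W : topologicalType} (d : W -> W -> R).
Hypothesis dxx : forall x, d x x = 0.
Hypothesis d_ge0 : forall x y, 0 <= d x y.
Hypothesis dC : forall x y, d x y = d y x.
Hypothesis d_triangle : forall x y z, d x z <= d x y + d y z.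
Hypothesis nbhs_d : forall x (V : set W),
  nbhs x V <-> exists2 r : R, 0 < r & forall y, d x y < r -> V y.

Lemma lipschitz_d_continuous (f : W -> R) (K : R) : 0 <= K ->
  (forall x y, f x <= f y + K * d x y) -> continuous f.
Proof.
move=> K0 fK x; apply/cvgrPdist_lt => e e0; apply/nbhs_d.
have K1 : 0 < K + 1 by rewrite ltr_wpDl.
exists (e / (K + 1)); first by rewrite divr_gt0.
move=> y; rewrite ltr_pdivlMr// => xy; rewrite /= ltr_norml.
have := fK x y; have := fK y x; rewrite (dC y x); have := d_ge0 x y; nra.
Qed.

(** For bounded [F] this is the least [n]-Lipschitz majorant of [F], the Pasch-Hausdorff envelope
    turned upside down. *)
Definition sup_convolution (F : W -> R) (n : nat) (x : W) : R :=
  sup [set F y - n%:R * d x y | y in [set: W]].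

Variables (F : W -> R) (a b : R).
Hypothesis Fa : forall x, a <= F x.
Hypothesis Fb : forall x, F x <= b.
Let G := sup_convolution F.

Let has_ubG n x : has_ubound [set F y - n%:R * d x y | y in [set: W]].
Proof.
exists b => _ [y _ <-]; have := Fb y.
by apply: le_trans; rewrite lerBlDr lerDl mulr_ge0.
Qed.

Let neG n x : [set F y - n%:R * d x y | y in [set: W]] !=set0.
Proof. by exists (F x - n%:R * d x x); exists x. Qed.

Lemma sup_convolution_ub n x y : F y - n%:R * d x y <= G n x.
Proof. by apply: ub_le_sup; [exact: has_ubG|exists y]. Qed.

Lemma sup_convolution_le n x : G n x <= b.
Proof.
apply: ge_sup => // _ [y _ <-]; have := Fb y.
by apply: le_trans; rewrite lerBlDr lerDl mulr_ge0.
Qed.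

Lemma sup_convolution_ge n x : F x <= G n x.
Proof. by have := sup_convolution_ub n x x; rewrite dxx mulr0 subr0. Qed.

Lemma sup_convolution_decreasing n x : G n.+1 x <= G n x.
Proof.
apply: ge_sup => // _ [y _ <-].
rewrite (le_trans _ (sup_convolution_ub n x y))// lerD2l lerN2.
by rewrite ler_wpM2r// ler_nat.
Qed.

Lemma sup_convolution_continuous n : continuous (G n).
Proof.
apply: (@lipschitz_d_continuous _ n%:R) => // x y.
apply: ge_sup => // _ [z _ <-].
rewrite -lerBlDr (le_trans _ (sup_convolution_ub n y z))//.
rewrite -addrA lerD2l -opprD lerN2 -mulrDr ler_wpM2l//.
by rewrite addrC (dC x y); exact: d_triangle.
Qed.

Lemma sup_convolution_cvg :
  (forall x c, F x < c -> \forall y \near x, F y < c) ->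
  forall x, G n x @[n --> \oo] --> F x.
Proof.
move=> Fusc x; apply/cvgrPdist_le => e e0.
have /nbhs_d[r r0 Fr] : \forall y \near x, F y < F x + e.
  by apply: Fusc; rewrite ltrDl.
have ab : 0 <= b - a by rewrite subr_ge0 (le_trans (Fa x)).
(* Beyond distance [r] the penalty is at least [n * r >= b - a], so such points contribute at most
   [F x]. Within [r], semicontinuity bounds [F] by [F x + e]. *)
have [N _ NP] := nbhs_infty_ger ((b - a) / r).
exists N => // n /NP /= nN; rewrite ler_distlC.
apply/andP; split.
  by rewrite (le_trans _ (sup_convolution_ge n x))// gerBl ltW.
apply: ge_sup => // _ [y _ <-].
have [xy|xy] := ltP (d x y) r.
  rewrite (le_trans _ (ltW (Fr _ xy)))// gerBl mulr_ge0//.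
have : b - a <= n%:R * d x y.
  rewrite (le_trans (y := n%:R * r))//; last by rewrite ler_wpM2l.
  by rewrite -ler_pdivrMr.
have := Fa x; have := Fb y; lra.
Qed.

End lipschitz_regularization.

(** * Continuous approximation from above on [Omega] *)

Section Omega_metric.
Context {R : realType} {T J : nat} {Om : set (ambient R T J)} {x0 : set_type Om}.

(** The matrix norm is the maximum norm. It is equivalent to the Euclidean one, and only the induced
    topology matters. *)
Definition Omega_dist (x y : Omega x0) : R :=
  `| (set_val x : 'M[R]_(T, J.+1)) - set_val y |.

Lemma nbhs_Omega_dist (x : Omega x0) (V : set (Omega x0)) :
  nbhs x V <-> exists2 r : R, 0 < r & forall y, Omega_dist x y < r -> V y.
Proof.
split.
- move=> [_ [[/= A oA <-] Ax] AV].
  have /nbhs_ballP[r /= r0 rA] : nbhs (set_val x : 'M[R]_(T, J.+1)) A.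
    exact: open_nbhs_nbhs.
  exists r => // y xy; apply: AV; apply: rA.
  by rewrite -ball_normE.
- move=> [r r0 rV].
  have xB : nbhs (set_val x : 'M[R]_(T, J.+1)) (ball (set_val x : 'M[R]_(T, J.+1)) r).
    exact: nbhsx_ballx r0.
  have xV : nbhs x (set_val @^-1` ball (set_val x : 'M[R]_(T, J.+1)) r).
    exact: (@initial_continuous (set_type Om) 'M[R]_(T, J.+1) set_val x _ xB).
  by apply: filterS xV => y /=; rewrite -ball_normE; exact: rV.
Qed.

Lemma usc_approx (F : Omega x0 -> R) (a b : R) :
  (forall x, a <= F x) -> (forall x, F x <= b) -> upper_semicontinuous F ->
  exists G : nat -> Omega x0 -> R, [/\ forall n, continuous (G n),
    forall n x, a <= G n x <= b, forall n x, G n.+1 x <= G n x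
    & forall x, G n x @[n --> \oo] --> F x].
Proof.
move=> Fa Fb Fusc; exists (sup_convolution Omega_dist F).
have dxx x : Omega_dist x x = 0 by rewrite /Omega_dist subrr normr0.
have d0 x y : 0 <= Omega_dist x y by exact: normr_ge0.
have dC x y : Omega_dist x y = Omega_dist y x by exact: distrC.
have dT x y z : Omega_dist x z <= Omega_dist x y + Omega_dist y z.
  exact: ler_distD.
split.
- move=> n; exact: (sup_convolution_continuous d0 dC dT nbhs_Omega_dist Fb).
- move=> n x; rewrite (sup_convolution_le d0 Fb) andbT.
  by rewrite (le_trans (Fa x))// (sup_convolution_ge dxx d0 Fb).
- by move=> n x; exact: (sup_convolution_decreasing d0 Fb).
- apply: (sup_convolution_cvg dxx d0 nbhs_Omega_dist Fa Fb).
  by move=> x c /Fusc[V xV VF]; exact: filterS xV.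
Qed.

(** The indicator of the complement of [G] is upper semicontinuous, hence a decreasing limit of
    continuous [f n]; the bumps are built from [1 - f n]. *)
Lemma open_bump (G : set (Omega x0)) : open G ->
  exists g : nat -> Omega x0 -> R, [/\ forall n, continuous (g n),
    forall n x, 0 <= g n x <= 1, forall n x, g n x <= g n.+1 x,
    forall n x, ~ G x -> g n x = 0
    & forall x, G x -> exists n, g n x = 1].
Proof.
move=> oG; pose F x : R := if x \in G then 0 else 1.
have F0 x : 0 <= F x by rewrite /F; case: ifP.
have F1 x : F x <= 1 by rewrite /F; case: ifP.
have Fusc : upper_semicontinuous F.
  move=> x a; rewrite /F; case: ifPn => [/set_mem Gx a0|_ a1].
    by exists G; [exact: open_nbhs_nbhs|move=> y /mem_set ->].
  exists setT; first exact: filterT.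
  by move=> y _; case: ifP => // _; rewrite (lt_trans _ a1).
have [f [cf f01 fdec fF]] := usc_approx F0 F1 Fusc.
have f_ge x : forall n, F x <= f n x := decreasing_cvg_ge (fdec ^~ x) (fF x).
(* The factor 2 makes the bump equal to 1 as soon as [f n x <= 1/2], hence at a finite stage and not
   only in the limit. *)
exists (fun n x => Num.min 1 (2 * (1 - f n x))); split.
- move=> n; apply: continuous_fmin; first exact: continuous_fcst.
  apply: continuous_fmul; first exact: continuous_fcst.
  by apply: continuous_fsub; [exact: continuous_fcst|exact: cf].
- move=> n x; have /andP[f0 f1] := f01 n x.
  by rewrite le_min ler01 ge_min lexx mulr_ge0// subr_ge0.
- move=> n x; rewrite le_min ge_min lexx/= ge_min; apply/orP; right.
  by rewrite ler_pM2l// lerD2l lerN2.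
- move=> n x Gx; have := f_ge x n; have /andP[_] := f01 n x.
  rewrite /F memNset// => f1 f1'; have -> : f n x = 1 by apply/eqP; rewrite eq_le f1.
  by rewrite subrr mulr0; apply/min_idPr.
- move=> x Gx; have := fF x; rewrite /F mem_set// => /cvgrPdist_le /(_ 2^-1).
  rewrite invr_gt0 ltr0n => /(_ isT)[N _ /(_ N (leqnn N))] /=.
  rewrite sub0r normrN ger0_norm; last by have /andP[] := f01 N x.
  by move=> fN; exists N; apply/min_idPl; lra.
Qed.

End Omega_metric.

(** * Daniell representation *)

Section measurable_semicontinuous.
Context {R : realType} {W : ptopologicalType}.
Local Notation B := (g_sigma_algebraType (@open W)).

Lemma open_borel (A : set W) : open A -> measurable (A : set B).
Proof. exact: sub_sigma_algebra. Qed.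

Lemma measurable_fun_usc (F : W -> R) :
  (forall x c, F x < c -> \forall y \near x, F y < c) ->
  measurable_fun [set: B] (F : B -> R).
Proof.
move=> Fusc; apply: (measurability _ (RGenInftyO.measurableE R)).
move=> _ [_ [x ->] <-]; rewrite setTI; apply: open_borel.
rewrite openE => w /=; rewrite in_itv/= => /Fusc.
by apply: filterS => y /=; rewrite in_itv.
Qed.

Lemma measurable_fun_continuous (F : W -> R) : continuous F ->
  measurable_fun [set: B] (F : B -> R).
Proof.
by move=> cF; apply: measurable_fun_usc => x c Fc; exact: (cvgr_lt _ (cF x) _ Fc).
Qed.

End measurable_semicontinuous.

(** * The vector lattice of continuous functions dominated by [Z] *)

Section dominated_continuous.
Context {R : realType} {W : topologicalType} (Z : W -> R).

(** This is [CZ] with its bound freed of division and on an arbitrary space; [CZE] identifies the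
    two. *)
Definition dominated_continuous : set (W -> R) :=
  [set f | continuous f /\ exists c, forall w, `|f w| <= c * Z w].
Local Notation E := dominated_continuous.
Implicit Types f g : W -> R.

Lemma dominated_linear (a : R) f g : E f -> E g -> E (fun w => a * f w + g w).
Proof.
move=> [cf [c fc]] [cg [b gb]]; split.
  apply: continuous_fadd => //; apply: continuous_fmul => //.
  exact: continuous_fcst.
exists (`|a| * c + b) => w; rewrite (le_trans (ler_normD _ _))//.
by rewrite mulrDl lerD// normrM -mulrA ler_wpM2l.
Qed.

Lemma dominated_max f g : E f -> E g -> E (fun w => Num.max (f w) (g w)).
Proof.
move=> [cf [c fc]] [cg [b gb]]; split; first exact: continuous_fmax.
exists (c + b) => w; rewrite mulrDl.
have fc0 := le_trans (normr_ge0 _) (fc w); have gb0 := le_trans (normr_ge0 _) (gb w).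
by rewrite /Num.max; case: ifP => _; [rewrite ler_wpDl|rewrite ler_wpDr].
Qed.

Lemma dominated_min f g : E f -> E g -> E (fun w => Num.min (f w) (g w)).
Proof.
move=> [cf [c fc]] [cg [b gb]]; split; first exact: continuous_fmin.
exists (c + b) => w; rewrite mulrDl.
have fc0 := le_trans (normr_ge0 _) (fc w); have gb0 := le_trans (normr_ge0 _) (gb w).
by rewrite /Num.min; case: ifP => _; [rewrite ler_wpDr|rewrite ler_wpDl].
Qed.

Lemma dominated_mul f g : E f -> continuous g -> (forall w, 0 <= g w <= 1) ->
  E (fun w => f w * g w).
Proof.
move=> [cf [c fc]] cg g01; split; first exact: continuous_fmul.
exists c => w; apply: le_trans (fc w); rewrite normrM.
by have /andP[g0 g1] := g01 w; rewrite (ger0_norm g0) ler_piMr.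
Qed.

Hypothesis Z1 : forall w, 1 <= Z w.

Lemma dominated_cst (a : R) : E (fun=> a).
Proof.
split; first exact: continuous_fcst.
by exists `|a| => w; rewrite ler_peMr.
Qed.

Lemma dominated_scale (a : R) f : E f -> E (fun w => a * f w).
Proof.
move=> Ef; have := dominated_linear a Ef (dominated_cst 0).
by under eq_fun do rewrite addr0.
Qed.

Lemma dominated_add f g : E f -> E g -> E (fun w => f w + g w).
Proof.
move=> Ef Eg; have := dominated_linear 1 Ef Eg.
by under eq_fun do rewrite mul1r.
Qed.

Lemma dominated_sub f g : E f -> E g -> E (fun w => f w - g w).
Proof.
move=> Ef Eg; have := dominated_linear (-1) Eg Ef.
by under eq_fun do rewrite mulN1r addrC.
Qed.

Lemma dominated_sum (F : nat -> W -> R) n : (forall k, E (F k)) ->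
  E (fun w => \sum_(k < n) F k w).
Proof.
move=> EF; elim: n => [|n IH].
  by under eq_fun do rewrite big_ord0; exact: dominated_cst.
by under eq_fun do rewrite big_ord_recr; exact: dominated_add.
Qed.

End dominated_continuous.

(** * From a positive functional to an outer measure and its integral *)

Section daniell.
Context {R : realType} {W : ptopologicalType} (Z : W -> R).
Hypothesis Z1 : forall w, 1 <= Z w.
Hypothesis Zc : continuous Z.
Hypothesis bump : forall G : set W, open G ->
  exists g : nat -> W -> R, [/\ forall n, continuous (g n),
    forall n x, 0 <= g n x <= 1, forall n x, g n x <= g n.+1 x,
    forall n x, ~ G x -> g n x = 0
    & forall x, G x -> exists n, g n x = 1].
Local Notation E := (dominated_continuous Z).
Variable L : (W -> R) -> R.
Hypothesis L_linear : forall (a : R) f g, E f -> E g ->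
  L (fun w => a * f w + g w) = a * L f + L g.
Hypothesis L_ge0 : forall f, E f -> (forall w, 0 <= f w) -> 0 <= L f.
Hypothesis L_continuous : forall f : nat -> W -> R, (forall n, E (f n)) ->
  (forall n w, 0 <= f n w) -> (forall n w, f n.+1 w <= f n w) ->
  (forall w, f n w @[n --> \oo] --> 0) ->
  forall e, 0 < e -> exists n, L (f n) <= e.

Implicit Types (f g h : W -> R) (A : set W).
Local Notation E0 := (dominated_cst Z1 0).

Lemma functional0 : L (fun=> 0) = 0.
Proof.
rewrite -[RHS](addNr (L (fun=> 0))) -mulN1r -(L_linear _ E0 E0).
by congr L; apply/funext => w; rewrite mulr0 addr0.
Qed.

Lemma functional_scale (a : R) f : E f -> L (fun w => a * f w) = a * L f.
Proof.
move=> Ef; rewrite -[RHS]addr0 -functional0 -L_linear//; last exact: E0.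
by congr L; apply/funext => w; rewrite addr0.
Qed.

Lemma functional_add f g : E f -> E g -> L (fun w => f w + g w) = L f + L g.
Proof.
move=> Ef Eg; rewrite -[L f]mul1r -L_linear//.
by congr L; apply/funext => w; rewrite mul1r.
Qed.

Lemma functional_sub f g : E f -> E g -> L (fun w => f w - g w) = L f - L g.
Proof.
move=> Ef Eg; rewrite addrC -mulN1r -L_linear//.
by congr L; apply/funext => w; rewrite mulN1r addrC.
Qed.

Lemma functional_sum (F : nat -> W -> R) n : (forall k, E (F k)) ->
  L (fun w => \sum_(k < n) F k w) = \sum_(k < n) L (F k).
Proof.
move=> EF; elim: n => [|n IH].
  by rewrite big_ord0 -[RHS]functional0; congr L; apply/funext => w; rewrite big_ord0.
rewrite big_ord_recr/= -IH -functional_add//; last exact: dominated_sum.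
by congr L; apply/funext => w; rewrite big_ord_recr.
Qed.

Lemma functional_le f g : E f -> E g -> (forall w, f w <= g w) -> L f <= L g.
Proof.
move=> Ef Eg fg; rewrite -subr_ge0 -functional_sub//; apply: L_ge0.
  exact: dominated_sub.
by move=> w; rewrite subr_ge0.
Qed.

(** The sequence stands for its supremum, a possibly infinite function that is at least 1 on [A].
    Asking for the value 1 at a finite stage keeps all functions real-valued. *)
Definition increasing_cover (A : set W) (f : nat -> W -> R) :=
  [/\ forall n, E (f n), forall n w, 0 <= f n w,
      forall n w, f n w <= f n.+1 w & forall w, A w -> exists n, 1 <= f n w].

Definition cover_cost (A : set W) (c : R) :=
  exists2 f, increasing_cover A f & forall n, L (f n) <= c.

Definition daniell_outer (A : set W) : \bar R :=
  ereal_inf [set c%:E | c in cover_cost A].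
Local Notation mu := daniell_outer.

Lemma increasing_cover_homo A (f : nat -> W -> R) n m w : increasing_cover A f -> (n <= m)%N ->
  f n w <= f m w.
Proof.
move=> [_ _ fS _]; have : nondecreasing_seq (f ^~ w) by apply/nondecreasing_seqP.
exact.
Qed.

Lemma cover_cost_le A c : cover_cost A c -> (mu A <= c%:E)%E.
Proof. by move=> Ac; apply: ereal_inf_lbound; exists c. Qed.

Lemma daniell_outer_lt A x : (mu A < x)%E ->
  exists2 c, cover_cost A c & (c%:E < x)%E.
Proof. by move=> /ereal_inf_lt[_ [c Ac <-] cx]; exists c. Qed.

Lemma daniell_outer_ge0 A : (0 <= mu A)%E.
Proof.
apply: le_ereal_inf_tmp => _ [c [f [Ef f0 _ _] fc] <-].
by rewrite lee_fin (le_trans _ (fc 0%N))// L_ge0.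
Qed.

Lemma daniell_outer_le_L A h : E h -> (forall w, 0 <= h w) ->
  (forall w, A w -> 1 <= h w) -> (mu A <= (L h)%:E)%E.
Proof.
move=> Eh h0 Ah; apply: cover_cost_le; exists (fun=> h) => //; split => //.
by move=> w /Ah; exists 0%N.
Qed.

(** For a cover [f] of [A], the functions [(h - f n)^+] decrease to 0: on [A] because [f n] reaches
    1, off [A] because [h] vanishes. Continuity of [L] makes them negligible, and
    [h <= f n + (h - f n)^+]. *)
Lemma daniell_outer_ge_L A h : E h -> (forall w, 0 <= h w) ->
  (forall w, h w <= 1) -> (forall w, ~ A w -> h w = 0) -> ((L h)%:E <= mu A)%E.
Proof.
move=> Eh h0 h1 hA; apply: le_ereal_inf_tmp => _ [c [f fcov fc] <-].
have [Ef f0 fS Af] := fcov; rewrite lee_fin; apply/ler_addgt0Pr => e e0.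
pose r n w := Num.max (h w - f n w) 0.
have Er n : E (r n).
  by apply: dominated_max; [exact: dominated_sub|exact: E0].
have [||w|n rn] := L_continuous Er _ _ _ e0.
- by move=> n w; rewrite /r le_max lexx orbT.
- move=> n w; rewrite /r ge_max !le_max lexx orbT andbT lerD2l lerN2.
  by rewrite fS.
- apply/cvgrPdist_le => d d0.
  have [N rN] : exists N, forall n, (N <= n)%N -> r n w = 0.
    have [Aw|nAw] := pselect (A w).
      have [N fN] := Af _ Aw; exists N => n Nn; apply/max_idPr.
      rewrite subr_le0 (le_trans (h1 w))// (le_trans fN)//.
      exact: increasing_cover_homo fcov Nn.
    by exists 0%N => n _; apply/max_idPr; rewrite hA// sub0r oppr_le0.
  by exists N => // n /= /rN ->; rewrite subrr normr0 ltW.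
- apply: (@le_trans _ _ (L (fun w => f n w + r n w))).
    apply: functional_le => //; first exact: dominated_add.
    by move=> w; rewrite -lerBlDl /r le_max lexx.
  by rewrite functional_add// lerD.
Qed.

Lemma daniell_outer0 : mu set0 = 0%E.
Proof.
apply/eqP; rewrite eq_le daniell_outer_ge0 andbT -[0%E]/(0%:E) -functional0.
by apply: daniell_outer_le_L => //; exact: E0.
Qed.

Lemma daniell_outer_sigma_subadditive A (F : nat -> set W) :
  subset_sigma_subadditive mu A F.
Proof.
move=> AF; apply/lee_addgt0Pr => e e0.
apply: le_trans (epsilon_trick _ _ (ltW e0)); last first.
  by move=> n; exact: daniell_outer_ge0.
pose eps n : R := e / (2 ^ n.+1)%:R.
have eps0 n : 0 < eps n by rewrite divr_gt0// ltr0n expn_gt0.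
rewrite -[leRHS]/(\sum_(0 <= n <oo) (mu (F n) + (eps n)%:E))%E.
have s0 n : (0 <= mu (F n) + (eps n)%:E)%E.
  by rewrite adde_ge0 ?daniell_outer_ge0// lee_fin ltW.
have [Foo|/existsNP[n /negP nF]] := pselect (forall n, (mu (F n) < +oo)%E); last first.
  rewrite (nneseries_pinfty (k := n)) ?leey//.
  by move: nF; rewrite -leNgt leye_eq => /eqP ->.
have cP n : exists c, cover_cost (F n) c /\ (c%:E <= mu (F n) + (eps n)%:E)%E.
  have /daniell_outer_lt[c Fc cmu] : (mu (F n) < mu (F n) + (eps n)%:E)%E.
    by rewrite lteDl ?lte_fin// ge0_fin_numE// daniell_outer_ge0.
  by exists c; split => //; exact: ltW.
have [c {}cP] := choice cP.
have fP n : exists f : nat -> W -> R, increasing_cover (F n) f /\ forall m, L (f m) <= c n.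
  by have [[f ? ?] _] := cP n; exists f.
have [f {}fP] := choice fP.
(* The diagonal sums turn countably many covers into one: [n] counts both the sets used and the
   stage reached in each cover. *)
pose h n w := \sum_(k < n) f k n w.
have f0 k n w : 0 <= f k n w by have [[]] := fP k.
have fE k n : E (f k n) by have [[]] := fP k.
have cle n : ((\sum_(k < n) c k)%:E <= \sum_(0 <= n <oo) (mu (F n) + (eps n)%:E))%E.
  apply: le_trans (nneseries_lim_ge n _); last by move=> k _ _; exact: s0.
  rewrite -sumEFin big_mkord; apply: lee_sum => k _.
  by have [] := cP k.
set S := (\sum_(0 <= n <oo) _)%E in cle *.
have : (0 <= S)%E by apply: nneseries_ge0 => n _ _; exact: s0.
move: cle; case: S => [s|_ _|//]; last by rewrite leey.
move=> cle _; apply: cover_cost_le; exists h.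
  split.
  - by move=> n; exact: (dominated_sum Z1 (F := fun k => f k n)).
  - by move=> n w; rewrite sumr_ge0.
  - move=> n w; rewrite /h big_ord_recr/= -[leLHS]addr0 lerD//.
    by apply: ler_sum => k _; have [[_ _ + _] _] := fP k; exact.
  - move=> w /AF[k _ Fkw]; have [fk _] := fP k.
    have [_ _ _ /(_ w Fkw)[m fm]] := fk.
    (* The index must exceed [k], for [f k] to occur in the sum, and reach the stage [m] at which
       [f k] is at least 1. *)
    exists (maxn k.+1 m); have kM : (k < maxn k.+1 m)%N by rewrite leq_max leqnn.
    rewrite /h (bigD1 (Ordinal kM))//= -[1]addr0 lerD ?sumr_ge0//.
    by rewrite (le_trans fm)// (increasing_cover_homo _ fk)// leq_maxr.
move=> n; rewrite (functional_sum (F := fun k => f k n))//; apply: le_trans (_ : \sum_(k < n) c k <= _); last first.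
  by rewrite -lee_fin.
by apply: ler_sum => k _; have [_] := fP k; exact.
Qed.

Definition daniell_outer_measure : {outer_measure set W -> \bar R} :=
  HB.pack mu (isSubsetOuterMeasure.Build R W mu daniell_outer0
    daniell_outer_ge0 daniell_outer_sigma_subadditive).

(** A cover [f] of [A] is split by the bumps [g] of [G]: the products [f n * g n] cover [A] inside
    [G], and [f n * (1 - g m)] with [m] fixed covers [A] outside [G]. Taking [m] with
    [L (f m * g m)] within [e] of the supremum makes the two costs add up to at most [c + e]. *)
Lemma open_caratheodory G : open G -> daniell_outer_measure.-caratheodory G.
Proof.
move=> /bump[g [cg g01 gS gN g1]]; apply: le_caratheodory_measurable => A /=.
apply: le_ereal_inf_tmp => _ [c [f fcov fc] <-].
have [Ef f0 fS Af] := fcov.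
have g_ge0 n w : 0 <= g n w by have /andP[] := g01 n w.
have g_le1 n w : g n w <= 1 by have /andP[] := g01 n w.
have g_homo n m w : (n <= m)%N -> g n w <= g m w.
  have : nondecreasing_seq (g ^~ w) by apply/nondecreasing_seqP.
  exact.
have f_homo n m w := @increasing_cover_homo A f n m w fcov.
pose u n w := f n w * g n w.
have Eu n : E (u n) by exact: dominated_mul.
have u_homo n m w : (n <= m)%N -> u n w <= u m w.
  by move=> nm; rewrite ler_pM// ?f_homo ?g_homo.
have Lu n : L (u n) <= c.
  by rewrite (le_trans _ (fc n))// functional_le// => w; rewrite ler_piMr.
pose S := [set L (u n) | n in [set: nat]].
have S0 : S !=set0 by exists (L (u 0%N)); exists 0%N.
have ubS : has_ubound S by exists c => _ [n _ <-].
have AG : (mu (A `&` G) <= (sup S)%:E)%E.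
  apply: cover_cost_le; exists u; last by move=> n; apply: ub_le_sup => //; exists n.
  split => //.
  - by move=> n w; rewrite mulr_ge0.
  - by move=> n w; exact: u_homo.
  - move=> w [/Af[n fn] /g1[m gm]]; exists (maxn n m).
    rewrite -[1]mulr1 ler_pM//; first by rewrite (le_trans fn)// f_homo// leq_maxl.
    by rewrite -gm g_homo// leq_maxr.
apply/lee_addgt0Pr => e e0.
have [_ [m _ <-] mS] := sup_adherent e0 (conj S0 ubS).
(* The shift by [m] gives [f m <= f (n + m)], so that [u m + v n <= f (n + m)] and the second cost
   is at most [c - L (u m)]. *)
pose v n w := f (n + m)%N w * (1 - g m w).
have cg' : continuous (fun w => 1 - g m w).
  by apply: continuous_fsub => //; exact: continuous_fcst.
have Ev n : E (v n).
  apply: dominated_mul => // w.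
  by rewrite subr_ge0 g_le1/= gerBl.
have AnG : (mu (A `&` ~` G) <= (c - L (u m))%:E)%E.
  apply: cover_cost_le; exists v.
    split => //.
    - by move=> n w; rewrite mulr_ge0// subr_ge0.
    - by move=> n w; rewrite ler_wpM2r// subr_ge0.
    - move=> w [/Af[n fn] Gw]; exists n; rewrite /v gN// subr0 mulr1.
      by rewrite (le_trans fn)// f_homo// leq_addr.
  move=> n; rewrite lerBrDr -functional_add// (le_trans _ (fc (n + m)%N))//.
  apply: functional_le => //; first exact: dominated_add.
  move=> w; rewrite /v /u mulrBr mulr1 -addrA gerDl.
  by rewrite addrC subr_le0 ler_wpM2r// f_homo// leq_addl.
apply: (le_trans (leeD AG AnG)); rewrite -!EFinD lee_fin.
by move: mS; rewrite ltrBlDr; lra.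
Qed.

Local Notation B := (g_sigma_algebraType (@open W)).

Lemma borel_caratheodory : measurable_fun [set: caratheodory_type daniell_outer_measure]
  (id : caratheodory_type daniell_outer_measure -> B).
Proof.
apply: (@measurability _ _ (caratheodory_type daniell_outer_measure) B setT id (@open W)) => // _ [G oG <-]; rewrite setTI.
exact: open_caratheodory.
Qed.

(** Pushing forward along the identity restricts the Caratheodory measure to the Borel sets. *)
Lemma daniell_measure : exists M : {measure set B -> \bar R}, forall A, M A = mu A.
Proof.
unshelve refine (ex_intro _ (pushforward
  (daniell_outer_measure : set (caratheodory_type daniell_outer_measure) -> _)
  (id : caratheodory_type daniell_outer_measure -> B) : {measure set B -> \bar R}) _).
  exact: borel_caratheodory.
by [].
Qed.

Section integral.
Variable M : {measure set B -> \bar R}.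
Hypothesis ME : forall A, M A = mu A.

(** The part of [n * f] between the heights [k] and [k + 1], lying between the indicators of two
    consecutive level sets. *)
Let slice f (n k : nat) w : R := Num.min (Num.max (n%:R * f w - k%:R) 0) 1.

Let E_slice f n k : E f -> E (slice f n k).
Proof.
move=> Ef; apply: dominated_min; last exact: dominated_cst.
apply: dominated_max; last exact: dominated_cst.
by apply: dominated_sub; [exact: dominated_scale|exact: dominated_cst].
Qed.

Let slice_ge0 f n k w : 0 <= slice f n k w.
Proof. by rewrite /slice le_min ler01 le_max lexx orbT. Qed.

Let slice_le1 f n k w : slice f n k w <= 1.
Proof. by rewrite /slice ge_min lexx orbT. Qed.

Lemma sum_slice (t : R) (K : nat) : 0 <= t ->
  \sum_(k < K) Num.min (Num.max (t - k%:R) 0) 1 = Num.min t K%:R.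
Proof.
move=> t0; elim: K => [|K IH].
  by rewrite big_ord0; apply/esym/min_idPr.
rewrite big_ord_recr/= IH -natr1.
have [tK|tK] := leP t K%:R.
  have -> : Num.max (t - K%:R) 0 = 0 by apply/max_idPr; rewrite subr_le0.
  have -> : Num.min 0 1 = 0 :> R by apply/min_idPl.
  by rewrite addr0; apply/esym/min_idPl; rewrite (le_trans tK)// lerDl.
have -> : Num.max (t - K%:R) 0 = t - K%:R by apply/max_idPl; rewrite subr_ge0 ltW.
by rewrite addr_minr addrC subrK.
Qed.

(** Each pair of terms lies in the interval from [a k.+1] to [a k], and the lengths of these
    intervals telescope. *)
Lemma sum_squeeze_dist (x y a : nat -> R) K :
  (forall k, a k.+1 <= x k <= a k) -> (forall k, a k.+1 <= y k <= a k) ->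
  `|\sum_(k < K) x k - \sum_(k < K) y k| <= a 0%N - a K.
Proof.
move=> xa ya; elim: K => [|K IH]; first by rewrite !big_ord0 !subrr normr0.
rewrite !big_ord_recr/= opprD addrACA.
have : `|x K - y K| <= a K - a K.+1.
  by rewrite ler_norml; have /andP[? ?] := xa K; have /andP[? ?] := ya K; lra.
move=> xy; rewrite (le_trans (ler_normD _ _))//; lra.
Qed.

Let level f (n k : nat) : set B := [set w | k%:R < n%:R * f w].

Let open_level f n k : continuous f -> open (level f n k : set W).
Proof.
move=> cf; rewrite openE => w /= kw.
have cnf : continuous (fun w => n%:R * f w).
  by apply: continuous_fmul => //; exact: continuous_fcst.
exact: (cvgr_gt _ (cnf w) _ kw).
Qed.

Let slice_out f n k w : ~ level f n k w -> slice f n k w = 0.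
Proof.
move=> /negP; rewrite -leNgt => nk; rewrite /slice.
have -> : Num.max (n%:R * f w - k%:R) 0 = 0 by apply/max_idPr; rewrite subr_le0.
by apply/min_idPl.
Qed.

Let slice_in f n k w : level f n k.+1 w -> slice f n k w = 1.
Proof.
rewrite /level/= -natr1 => nk; apply/min_idPr.
by rewrite le_max; apply/orP; left; rewrite lerBrDl ltW.
Qed.

(** The integral and [L] of the [k]-th slice both lie between the measures of the level sets [k + 1]
    and [k]. Summing the slices, the error telescopes to at most [L 1], and the scaling divides it
    by [n]. *)
Lemma integral_trunc f n : E f -> (forall w, 0 <= f w) -> (0 < n)%N ->
  exists2 x : R, (\int[M]_w (Num.min (f w) n%:R)%:E)%E = x%:E &
    `|x - L (fun w => Num.min (f w) n%:R)| <= L (fun=> 1) / n%:R.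
Proof.
move=> Ef f0 n0; have nn0 : n%:R != 0 :> R by rewrite pnatr_eq0 -lt0n.
have E1 : E (fun=> 1) by exact: dominated_cst.
pose h := slice f n; pose A := level f n.
have mA k : measurable (A k) by apply: open_borel; apply: open_level; case: Ef.
have mh k : measurable_fun [set: B] (fun w : B => (h k w)%:E).
  apply/measurable_EFinP; apply: measurable_fun_continuous.
  by have [] := E_slice n k Ef.
have MA_fin k : M (A k) \is a fin_num.
  rewrite ge0_fin_numE// ME; apply: (@le_lt_trans _ _ (L (fun=> 1))%:E); last exact: ltry.
  by apply: daniell_outer_le_L.
have inth k : (M (A k.+1) <= \int[M]_w (h k w)%:E <= M (A k))%E.
  rewrite -[A k.+1]setIT -[A k]setIT -!integral_indic//.
  have mI k' : measurable_fun [set: B] (fun w : B => (\1_(A k') w : R)%:E).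
    by apply/measurable_EFinP; exact: measurable_indic.
  apply/andP; split; (apply: ge0_le_integral; first exact: measurableT).
  - by move=> w _; rewrite lee_fin indicE ler0n.
  - exact: mI.
  - exact: mh.
  - move=> w _; rewrite lee_fin indicE; case: (boolP (w \in A k.+1)) => [/set_mem wA|_].
      by rewrite /h slice_in.
    exact: slice_ge0.
  - by move=> w _; rewrite lee_fin; exact: slice_ge0.
  - exact: mh.
  - exact: mI.
  - move=> w _; rewrite lee_fin indicE; case: (boolP (w \in A k)) => [_|/negP wA].
      exact: slice_le1.
    by rewrite /h slice_out// => /mem_set.
have inth_fin k : (\int[M]_w (h k w)%:E)%E \is a fin_num.
  have /andP[_ hA] := inth k; rewrite ge0_fin_numE.
    by rewrite (le_lt_trans hA)// -ge0_fin_numE.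
  by apply: integral_ge0 => w _; rewrite lee_fin; exact: slice_ge0.
pose a k := fine (M (A k)); pose i k := fine (\int[M]_w (h k w)%:E)%E.
have ia k : a k.+1 <= i k <= a k.
  by rewrite -!lee_fin !fineK.
have La k : a k.+1 <= L (h k) <= a k.
  rewrite -!lee_fin !fineK// !ME; apply/andP; split.
    apply: daniell_outer_le_L; [exact: E_slice|exact: slice_ge0|].
    by move=> w wA; rewrite /h slice_in.
  apply: daniell_outer_ge_L; [exact: E_slice|exact: slice_ge0|exact: slice_le1|].
  by move=> w; exact: slice_out.
(* Cutting [n * f] at height [n * n] means cutting [f] at height [n]. *)
have truncE w : Num.min (f w) n%:R = n%:R^-1 * \sum_(k < n * n) h k w.
  rewrite sum_slice ?mulr_ge0// natrM -minr_pMr; last by rewrite ler0n.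
  by rewrite mulKf.
exists (n%:R^-1 * \sum_(k < n * n) i k).
  have h0 k w : (0 <= (h k w)%:E)%E by rewrite lee_fin; exact: slice_ge0.
  have mS : measurable_fun [set: B] (fun w : B => \sum_(k < n * n) (h k w)%:E)%E.
    by apply: emeasurable_sum => k; exact: mh.
  under eq_integral do rewrite truncE EFinM -sumEFin.
  rewrite (ge0_integralZl M measurableT mS) ?lee_fin ?invr_ge0//; last first.
    by move=> w _; apply: sume_ge0 => k _; exact: h0.
  rewrite (ge0_integral_sum M measurableT (fun k : 'I_(n * n) => mh k))//.
  by rewrite EFinM -sumEFin; congr (_ * _)%E; apply: eq_bigr => k _; rewrite fineK.
have -> : L (fun w => Num.min (f w) n%:R) = n%:R^-1 * \sum_(k < n * n) L (h k).
  have Eh k : E (h k) by exact: E_slice.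
  rewrite -(functional_sum _ Eh) -functional_scale; last exact: dominated_sum.
  by congr L; apply/funext.
rewrite -mulrBr normrM ger0_norm ?invr_ge0// mulrC ler_wpM2r ?invr_ge0//.
apply: (le_trans (sum_squeeze_dist _ ia La)).
have aK : 0 <= a (n * n)%N by rewrite fine_ge0.
apply: (@le_trans _ _ (a 0%N)); first by rewrite gerBl.
rewrite -lee_fin fineK// ME; exact: daniell_outer_le_L.
Qed.

(** The truncations converge for the integral by monotone convergence and for [L] by its continuity
    on the remainders, while [integral_trunc] compares the two. Truncating at [n.+1] keeps its
    divisor positive. *)
Lemma integral_daniell_ge0 f : E f -> (forall w, 0 <= f w) ->
  (\int[M]_w (f w)%:E)%E = (L f)%:E.
Proof.
move=> Ef f0; have cf : continuous f by case: Ef.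
pose t (n : nat) w : R := Num.min (f w) n.+1%:R.
have Et n : E (t n) by apply: dominated_min => //; exact: dominated_cst.
have E1 : E (fun=> 1) by exact: dominated_cst.
have xP n : exists x : R, (\int[M]_w (t n w)%:E)%E = x%:E /\
    `|x - L (t n)| <= L (fun=> 1) / n.+1%:R.
  by have [x xI xL] := integral_trunc Ef f0 (ltn0Sn n); exists x.
have [x {}xP] := choice xP.
have t_le n w : t n w <= f w by rewrite /t ge_min lexx.
have t_homo w : {homo (t ^~ w) : n m / (n <= m)%N >-> n <= m}.
  move=> n m nm; rewrite /t le_min !ge_min lexx/=.
  by rewrite ler_nat ltnS nm orbT.
have t_cvg w : t n w @[n --> \oo] --> f w.
  apply/cvgrPdist_le => e e0; have [N _ NP] := nbhs_infty_ger (f w).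
  exists N => // n /NP /= fn.
  have fnS : f w <= n.+1%:R by rewrite (le_trans fn)// ler_nat.
  by rewrite /t (min_idPl fnS) subrr normr0 ltW.
have intf : (\int[M]_w (t n w)%:E)%E @[n --> \oo] --> (\int[M]_w (f w)%:E)%E.
  have -> : (\int[M]_w (f w)%:E)%E = (\int[M]_w (fun w => limn (fun n => (t n w)%:E)) w)%E.
    apply: eq_integral => w _; apply/esym/cvg_lim => //.
    by apply: cvg_EFin; [exact: nearW|exact: t_cvg].
  apply: cvg_monotone_convergence => //.
  - move=> n; apply/measurable_EFinP; apply: measurable_fun_continuous.
    by have [] := Et n.
  - by move=> n w _; rewrite lee_fin /t le_min f0 ler0n.
  - by move=> w _ n m nm; rewrite lee_fin t_homo.
have intL : (\int[M]_w (t n w)%:E)%E @[n --> \oo] --> (L f)%:E.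
  under eq_fun do rewrite (proj1 (xP _)).
  apply: cvg_EFin; first exact: nearW.
  apply/cvgrPdist_le => e e0.
  have e20 : 0 < e / 2 by rewrite divr_gt0.
  pose r n w := f w - t n w.
  have Er n : E (r n) by exact: dominated_sub.
  have r_le n m w : (n <= m)%N -> r m w <= r n w.
    by move=> nm; rewrite lerD2l lerN2 t_homo.
  have [||w|N rN] := L_continuous Er _ _ _ e20.
  - by move=> n w; rewrite subr_ge0.
  - by move=> n w; exact: r_le.
  - rewrite -[X in _ --> X](subrr (f w)); apply: cvgB => //; exact: cvg_cst.
  have [N' _ N'P] := nbhs_infty_ger (L (fun=> 1) / (e / 2)).
  exists (maxn N N') => // n /=; rewrite geq_max => /andP[Nn N'n].
  have [_ xn] := xP n.
  have x2 : `|x n - L (t n)| <= e / 2.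
    rewrite (le_trans xn)// ler_pdivrMr ?ltr0n// mulrC -ler_pdivrMr//.
    by rewrite (le_trans (N'P _ N'n))// ler_nat.
  have r2 : `|L f - L (t n)| <= e / 2.
    rewrite -functional_sub// ger0_norm; last first.
      by apply: (L_ge0 (Er n)) => w; rewrite subr_ge0.
    by apply: le_trans rN; apply: (functional_le (Er n) (Er N)) => w; exact: r_le.
  rewrite (_ : L f - x n = (L f - L (t n)) - (x n - L (t n))); last by ring.
  by rewrite (le_trans (ler_normB _ _))// [leRHS]splitr lerD.
by apply/esym; rewrite -(cvg_lim _ intL)// (cvg_lim _ intf).
Qed.

Lemma integral_daniell f : E f ->
  M.-integrable [set: B] (EFin \o f) /\ (\int[M]_w (f w)%:E)%E = (L f)%:E.
Proof.
have EZ : E Z.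
  by split => //; exists 1 => w; rewrite mul1r ger0_norm// (le_trans ler01).
have mE g : E g -> measurable_fun [set: B] (EFin \o g).
  move=> [cg _]; apply/measurable_EFinP; exact: measurable_fun_continuous.
have intE g : E g -> (forall w, 0 <= g w) -> M.-integrable [set: B] (EFin \o g).
  move=> Eg g0; apply/integrableP; split; first exact: mE.
  under eq_integral do rewrite /= ger0_norm//.
  by rewrite integral_daniell_ge0// ltry.
move=> Ef; have [_ [c fc]] := Ef.
have Ec : E (fun w => c * Z w) by exact: dominated_scale.
have c0 w : 0 <= c * Z w by exact: le_trans (normr_ge0 _) (fc w).
have Efc : E (fun w => f w + c * Z w) by exact: dominated_add.
have fc0 w : 0 <= f w + c * Z w.
  by have := fc w; rewrite ler_norml => /andP[]; lra.
(* Adding [c * Z] writes [f] as a difference of nonnegative members of [E]. *)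
have fE : f = (fun w => (f w + c * Z w) - c * Z w).
  by apply/funext => w; rewrite addrK.
have If : M.-integrable [set: B] (EFin \o f).
  rewrite fE; apply: eq_integrable (integrableB _ (intE _ Efc fc0) (intE _ Ec c0)) => //.
split => //; rewrite [in LHS]fE.
under eq_integral do rewrite EFinB.
rewrite integralB//; [|exact: intE..].
rewrite !integral_daniell_ge0// -EFinB -functional_sub//.
by congr (L _)%:E; apply/funext => w; rewrite addrK.
Qed.

End integral.

Theorem daniell_representation : exists M : {measure set B -> \bar R},
  forall f, E f -> M.-integrable [set: B] (EFin \o f) /\
    (\int[M]_w (f w)%:E)%E = (L f)%:E.
Proof.
by have [M ME] := daniell_measure; exists M => f Ef; exact: integral_daniell.
Qed.

End daniell.

(** * Dini's theorem and continuity of tight functionals *)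

Section dini.
Context {R : realType} {W : ptopologicalType}.

Lemma dini_near (K : set W) (f : nat -> W -> R) (e : R) : compact K ->
  (forall n, continuous (f n)) -> (forall n w, f n.+1 w <= f n w) ->
  (forall w, f n w @[n --> \oo] --> 0) -> 0 < e ->
  exists n, forall w, K w -> f n w <= e.
Proof.
move=> /compact_near_coveringP cK cf fS f0 e0.
have f_homo n m w : (n <= m)%N -> f m w <= f n w := @decreasing_le R _ (fS ^~ w) n m.
have [|N _ NP] := cK nat \oo (fun n w => f n w <= e).
  move=> w _; have [N _ /(_ N (leqnn N))/= fN] := cvgr_lt _ (f0 w) _ e0.
  exists ([set y | f N y < e], [set n | (N <= n)%N]) => /=.
    by split; [exact: (cvgr_lt _ (cf N w) _ fN)|exists N].
  by move=> [y n] /= [fy Nn]; rewrite (le_trans (f_homo _ _ _ Nn))// ltW.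
by exists N => w Kw; exact: (NP N (leqnn N) w Kw).
Qed.

Variable Z : W -> R.
Hypothesis Z1 : forall w, 1 <= Z w.
Hypothesis Zc : continuous Z.
Hypothesis ZK : forall z : R, 0 <= z -> compact [set w | Z w <= z].
Local Notation E := (dominated_continuous Z).
Variable L : (W -> R) -> R.
Hypothesis L_linear : forall (a : R) f g, E f -> E g ->
  L (fun w => a * f w + g w) = a * L f + L g.
Hypothesis L_ge0 : forall f, E f -> (forall w, 0 <= f w) -> 0 <= L f.
Hypothesis L_tail : forall e : R, 0 < e ->
  exists2 z, 0 <= z & L (fun w => Num.max (Z w - z) 0) <= e.

(** Dini's theorem makes [f n] small on the compact set where [Z <= 2 * z]. Elsewhere
    [Z <= 2 * (Z - z)^+], so [f n <= f 0] is bounded by a multiple of the tail, on which [L] is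
    small. *)
Lemma tight_functional_continuous (f : nat -> W -> R) : (forall n, E (f n)) ->
  (forall n w, 0 <= f n w) -> (forall n w, f n.+1 w <= f n w) ->
  (forall w, f n w @[n --> \oo] --> 0) ->
  forall e : R, 0 < e -> exists n, L (f n) <= e.
Proof.
move=> Ef f0 fS fcvg e e0; have [_ [c fc]] := Ef 0%N.
have E1 : E (fun=> 1) by exact: dominated_cst.
have EZ : E Z.
  by split => //; exists 1 => w; rewrite mul1r ger0_norm// (le_trans ler01).
have L1 : 0 <= L (fun=> 1) by exact: L_ge0.
have L11 : 0 < L (fun=> 1) + 1 by rewrite ltr_wpDl.
have c1 : 0 < `|c| + 1 by rewrite ltr_wpDl.
have [z z0 Lz] := L_tail (divr_gt0 (divr_gt0 e0 (ltr0n _ 4)) c1).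
pose d := e / 2 / (L (fun=> 1) + 1).
have d0 : 0 < d by rewrite !divr_gt0.
have z20 : 0 <= 2 * z by rewrite mulr_ge0.
have [n fn] := dini_near (ZK z20) (fun n => proj1 (Ef n)) fS fcvg d0.
exists n; pose V w := Num.max (Z w - z) 0.
have EV : E V.
  apply: (dominated_max (f := fun w => Z w - z)); last exact: dominated_cst.
  by apply: dominated_sub => //; exact: dominated_cst.
(* By the choice of [z] and [d], each of the two terms of [L h] is at most [e / 2]. *)
pose h w := 2 * (`|c| + 1) * V w + d * 1.
have Eh : E h by apply: dominated_linear => //; exact: dominated_scale.
have V0 w : 0 <= V w by rewrite /V le_max lexx orbT.
have fh w : f n w <= h w.
  have [Zw|Zw] := leP (Z w) (2 * z).
    rewrite (le_trans (fn w Zw))// /h mulr1 lerDr.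
    by apply: mulr_ge0.
  have fn0 : f n w <= f 0%N w := decreasing_le (fS ^~ w) (leq0n n).
  have fc1 : f 0%N w <= (`|c| + 1) * Z w.
    rewrite (le_trans (ler_norm _))// (le_trans (fc w))// ler_wpM2r//.
      by rewrite (le_trans ler01).
    by rewrite (le_trans (ler_norm c))// lerDl.
  have VZ : Z w - z <= V w by rewrite /V le_max lexx.
  rewrite (le_trans fn0)// (le_trans fc1)// /h mulr1.
  have : (`|c| + 1) * Z w <= (`|c| + 1) * (2 * V w).
    by apply: ler_wpM2l; [exact: ltW|lra].
  by move: d0; lra.
have Lh : L h = 2 * (`|c| + 1) * L V + d * L (fun=> 1).
  rewrite /h L_linear//; last exact: dominated_scale.
  by rewrite (functional_scale Z1 L_linear).
rewrite (le_trans (functional_le L_linear L_ge0 (Ef n) Eh fh))// Lh.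
have : 2 * (`|c| + 1) * L V <= e / 2.
  have -> : e / 2 = 2 * (`|c| + 1) * (e / 4 / (`|c| + 1)).
    by field; rewrite gt_eqF.
  by rewrite ler_wpM2l// mulr_ge0// ltW.
have : d * L (fun=> 1) <= e / 2.
  rewrite /d -mulrA ler_piMr//; first by rewrite divr_ge0// ltW.
  by rewrite mulrC ler_pdivrMr// mul1r lerDl.
lra.
Qed.

End dini.

(** * Duality between U_Z and ca_Z^+ *)

Section spaces.
Context {R : realType} {T J : nat} {Om : set (ambient R T J)} {x0 : set_type Om}.
Variable Z : Omega x0 -> R.
Hypothesis Z1 : forall w, 1 <= Z w.
Hypothesis Zc : continuous Z.
Implicit Types X Y : Omega x0 -> R.
Local Notation E := (dominated_continuous Z).

Let Z_gt0 w : 0 < Z w. Proof. by rewrite (lt_le_trans ltr01). Qed.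

Lemma ratio_boundedE X :
  ratio_bounded Z X <-> exists c, forall w, `|X w| <= c * Z w.
Proof.
by split=> -[c cX]; exists c => w; have := cX w;
  rewrite normrM normfV (gtr0_norm (Z_gt0 w)) ler_pdivrMr.
Qed.

Lemma CZE X : CZ Z X <-> E X.
Proof. by split=> -[cX /ratio_boundedE bX]; split. Qed.

Lemma usc_nearE X : upper_semicontinuous X <->
  (forall x c, X x < c -> \forall y \near x, X y < c).
Proof.
split=> H w a /H; first by move=> [V wV VX]; exact: filterS wV.
by exists [set y | X y < a].
Qed.

Lemma continuous_usc X : continuous X -> upper_semicontinuous X.
Proof. by move=> cX; apply/usc_nearE => x c Xc; exact: (cvgr_lt _ (cX x) _ Xc). Qed.

Lemma usc_add X Y : upper_semicontinuous X -> upper_semicontinuous Y ->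
  upper_semicontinuous (fun w => X w + Y w).
Proof.
move=> /usc_nearE uX /usc_nearE uY; apply/usc_nearE => x c xc.
pose e := (c - (X x + Y x)) / 2.
have e0 : 0 < e by rewrite divr_gt0// subr_gt0.
have xe : X x < X x + e by rewrite ltrDl.
have ye : Y x < Y x + e by rewrite ltrDl.
apply: filterS2 (uX _ _ xe) (uY _ _ ye) => y.
have -> : c = X x + e + (Y x + e) by rewrite /e; field.
exact: ltrD.
Qed.

Lemma CZ_UZ X : CZ Z X -> UZ Z X.
Proof. by move=> [cX bX]; split => //; exact: continuous_usc. Qed.

Lemma UZ_add X Y : UZ Z X -> UZ Z Y -> UZ Z (fun w => X w + Y w).
Proof.
move=> [uX /ratio_boundedE[a aX]] [uY /ratio_boundedE[b bY]]; split.
  exact: usc_add.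
apply/ratio_boundedE; exists (a + b) => w.
by rewrite (le_trans (ler_normD _ _))// mulrDl lerD.
Qed.

Lemma UZ_approx X : UZ Z X -> exists Y : nat -> Omega x0 -> R,
  [/\ forall n, CZ Z (Y n), forall n w, Y n.+1 w <= Y n w
    & forall w, Y n w @[n --> \oo] --> X w].
Proof.
move=> [uX [c cX]].
have XZ w : - c <= X w / Z w <= c by rewrite -ler_norml.
(* The condition [X / Z < a] is [X - a * Z < 0], and [X - a * Z] is upper semicontinuous for either
   sign of [a]. *)
have uF : upper_semicontinuous (fun w => X w / Z w).
  have main (a : R) : upper_semicontinuous (fun w => X w + (- a) * Z w).
    apply: usc_add => //; apply: continuous_usc; apply: continuous_fmul => //.
    exact: continuous_fcst.
  move=> w a; rewrite ltr_pdivrMr// -subr_lt0 -mulNr => /(main a)[V wV VX].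
  exists V => // y /VX; rewrite mulNr subr_lt0; by rewrite ltr_pdivrMr.
have [G [cG Gc Gdec GX]] := usc_approx (fun w => proj1 (andP (XZ w)))
  (fun w => proj2 (andP (XZ w))) uF.
exists (fun n w => G n w * Z w); split.
- move=> n; apply/CZE; split; first exact: continuous_fmul.
  exists c => w; rewrite normrM (gtr0_norm (Z_gt0 w)).
  apply: ler_wpM2r; first exact: ltW.
  by rewrite ler_norml Gc.
- by move=> n w; rewrite ler_wpM2r// ltW.
- move=> w; rewrite -[X in _ --> X](divfK (lt0r_neq0 (Z_gt0 w))).
  by apply: cvgM; [exact: GX|exact: cvg_cst].
Qed.

Lemma UZ_integrable (mu : {measure set (Borel x0) -> \bar R}) X :
  caZ Z mu -> UZ Z X -> mu.-integrable [set: Borel x0] (EFin \o X).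
Proof.
move=> muZ [uX /ratio_boundedE[c cX]].
have mZ : measurable_fun [set: Borel x0] (Z : Borel x0 -> R).
  exact: measurable_fun_continuous.
have iZ : mu.-integrable [set: Borel x0] (EFin \o Z).
  apply/integrableP; split; first exact/measurable_EFinP.
  by under eq_integral do rewrite /= (gtr0_norm (Z_gt0 _)).
apply: (@le_integrable _ _ _ _ _ measurableT _ (fun w : Borel x0 => c%:E * (Z w)%:E)%E).
- apply/measurable_EFinP; apply: measurable_fun_usc; exact/usc_nearE.
- move=> w _ /=; rewrite lee_fin (le_trans (cX w))//.
  by rewrite ler_norm.
- exact: integrableZl.
Qed.

Lemma pairing_fin (mu : {measure set (Borel x0) -> \bar R}) X :
  caZ Z mu -> UZ Z X -> pairing X mu \is a fin_num.
Proof.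
by move=> muZ UX; apply: integrable_fin_num => //; exact: UZ_integrable.
Qed.

Lemma le_pairing (mu : {measure set (Borel x0) -> \bar R}) X Y :
  caZ Z mu -> UZ Z X -> UZ Z Y -> (forall w, X w <= Y w) ->
  (pairing X mu <= pairing Y mu)%E.
Proof.
move=> muZ UX UY XY; apply: le_integral => //; [exact: UZ_integrable..|].
by move=> w _; rewrite lee_fin.
Qed.

Lemma pairing_sub (mu : {measure set (Borel x0) -> \bar R}) X Y :
  caZ Z mu -> UZ Z X -> UZ Z Y ->
  pairing (fun w => X w - Y w) mu = (pairing X mu - pairing Y mu)%E.
Proof.
move=> muZ UX UY; rewrite /pairing.
under eq_integral do rewrite EFinB.
by rewrite integralB//; exact: UZ_integrable.
Qed.

Lemma cvg_pairing (mu : {measure set (Borel x0) -> \bar R}) X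
    (Y : nat -> Omega x0 -> R) : caZ Z mu -> UZ Z X -> (forall n, UZ Z (Y n)) ->
  (forall n w, Y n.+1 w <= Y n w) -> (forall w, Y n w @[n --> \oo] --> X w) ->
  pairing (Y n) mu @[n --> \oo] --> pairing X mu.
Proof.
move=> muZ UX UY YS YX.
have Y_homo n m w : (n <= m)%N -> Y m w <= Y n w := @decreasing_le R _ (YS ^~ w) n m.
have XY n w : X w <= Y n w := decreasing_cvg_ge (YS ^~ w) (YX w) n.
have iX := UZ_integrable muZ UX; have iY n := UZ_integrable muZ (UY n).
have [] := @dominated_convergence _ _ _ mu _ measurableT
  (fun n (w : Borel x0) => (Y n w)%:E) (fun w => (X w)%:E)
  (* This dominates every [Y n], since [X <= Y n <= Y 0]. *)
  (fun w => `|(X w)%:E| + `|(Y 0%N w)%:E|)%E.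
- by move=> n; have /integrableP[] := iY n.
- by have /integrableP[] := iX.
- by apply: aeW => w _; apply: cvg_EFin; [exact: nearW|exact: YX].
- by apply: integrableD => //; [exact: (integrable_abse iX)|exact: (integrable_abse (iY 0%N))].
- apply: aeW => w n _; rewrite -EFinD lee_fin.
  have := XY n w; have := Y_homo 0%N n w (leq0n n).
  have := ler_norm (Y 0%N w); have := ler_norm (- X w); rewrite normrN => a b c d.
  have X0 : 0 <= `|X w| by []. have Y0 : 0 <= `|Y 0%N w| by [].
  by rewrite ler_norml; apply/andP; split; lra.
- by [].
Qed.

Lemma conj_on_ge (S : set (Omega x0 -> R)) psi (mu : {measure set (Borel x0) -> \bar R}) X :
  S X -> (pairing X mu - (psi X)%:E <= conj_on S psi mu)%E.
Proof. by move=> SX; apply: ereal_sup_ubound; exists X. Qed.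

End spaces.

(** * Subgradients represented by measures *)

Section duality.
Context {R : realType} {T J : nat} {Om : set (ambient R T J)} {x0 : set_type Om}.
Variable Z : Omega x0 -> R.
Hypothesis Z1 : forall w, 1 <= Z w.
Hypothesis Zc : continuous Z.
Hypothesis ZK : forall z : R, 0 <= z -> compact [set w | Z w <= z].
Variable psi : (Omega x0 -> R) -> R.
Hypothesis psi_inc : increasing_on (UZ Z) psi.
Hypothesis psi_conv : convex_on (UZ Z) psi.
Hypothesis psi_lim : forall n : nat,
  psi (fun w => n%:R * Num.max (Z w - z) 0) @[z --> +oo] --> psi (fun=> 0).
Local Notation E := (dominated_continuous Z).
Implicit Types X Y V : Omega x0 -> R.

Let E_UZ V : E V -> UZ Z V.
Proof. by move=> /(CZE Z1); exact: CZ_UZ. Qed.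

Let EZ : E Z.
Proof. by split => //; exists 1 => w; rewrite mul1r ger0_norm// (le_trans ler01). Qed.

Let E_excess z : E (fun w => Num.max (Z w - z) 0).
Proof.
apply: (dominated_max (f := fun w => Z w - z)); last exact: dominated_cst.
by apply: dominated_sub => //; exact: dominated_cst.
Qed.

(* The hypothesis on psi bounds psi (n (Z - z)^+) for large z; halving the
   increment and using convexity transfers this bound from 0 to X. *)
Lemma subgradient_tail X (L : (Omega x0 -> R) -> R) (l : R) : UZ Z X ->
  (forall (a : R) f, E f -> L (fun w => a * f w) = a * L f) ->
  (forall V, E V -> L V <= psi (fun w => X w + V w) - l) ->
  forall e : R, 0 < e -> exists2 z, 0 <= z & L (fun w => Num.max (Z w - z) 0) <= e.
Proof.
move=> UX LZ LX e e0.
(* [K] bounds [n / 2 * L ((Z - z)^+)] once [z] is large in terms of [n], and does not depend on [n];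
   hence [n >= 2 * |K| / e] suffices. *)
pose K := 2^-1 * psi (fun w => X w + X w) + 2^-1 * (psi (fun=> 0) + 1) - l.
have [N _ NP] := nbhs_infty_ger (2 * `|K| / e).
pose n := N.+1.
have n0 : 0 < n%:R :> R by rewrite ltr0n.
have nK : 2 * `|K| / e <= n%:R by apply: NP; rewrite /= /n leqnSn.
have p1 : psi (fun=> 0) < psi (fun=> 0) + 1 by rewrite ltrDl.
have near_z : \forall z \near +oo,
    psi (fun w => n%:R * Num.max (Z w - z) 0) < psi (fun=> 0) + 1 /\ 0 <= z.
  apply: filterI; first exact: (cvgr_lt _ (@psi_lim n) _ p1).
  exact: (nbhs_pinfty_ge (num_real (0 : R))).
have [z [psiz z0]] := filter_ex near_z; exists z => //.
pose V w := Num.max (Z w - z) 0; have EV : E V by exact: E_excess.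
have UnV : UZ Z (fun w => n%:R * V w) by apply: E_UZ; exact: dominated_scale.
have := LX _ (dominated_scale Z1 (n%:R / 2) EV); rewrite LZ//.
have -> : (fun w => X w + n%:R / 2 * V w) =
    (fun w => 2^-1 * (X w + X w) + (1 - 2^-1) * (n%:R * V w)).
  by apply/funext => w; field.
have h01 : 0 <= (2^-1 : R) <= 1 by rewrite invr_ge0 ler0n/= invf_le1// ler1n.
have := psi_conv (UZ_add Z1 UX UX) UnV h01 => h1 h2.
have {h1 h2} nL : n%:R / 2 * L V <= K.
  by move: psiz h1 h2; rewrite /K -/V; lra.
have : n%:R * L V <= n%:R * e.
  apply: (@le_trans _ _ (2 * `|K|)); last by rewrite -ler_pdivrMr.
  by have := ler_norm K; move: nL; lra.
by rewrite ler_pM2l.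
Qed.

Section subgradient.
Variables (Xs : nat -> Omega x0 -> R) (X : Omega x0 -> R).
Hypothesis UXs : forall n, UZ Z (Xs n).
Hypothesis UX : UZ Z X.
Hypothesis Xs_dec : forall n w, Xs n.+1 w <= Xs n w.
Hypothesis Xs_ge : forall n w, X w <= Xs n w.

Let l := inf [set psi (Xs n) | n in [set: nat]].
Let values V := [set psi (fun w => Xs n w + V w) | n in [set: nat]].

Let values_neq0 V : values V !=set0.
Proof. by exists (psi (fun w => Xs 0%N w + V w)); exists 0%N. Qed.

Let U_shift n V : E V -> UZ Z (fun w => Xs n w + V w).
Proof. by move=> EV; apply: UZ_add => //; exact: E_UZ. Qed.

Let values_lb V : E V -> has_lbound (values V).
Proof.
move=> EV; exists (psi (fun w => X w + V w)) => _ [n _ <-].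
apply: psi_inc => [||w]; [exact: U_shift|by apply: UZ_add => //; exact: E_UZ|].
by rewrite lerD2r.
Qed.

Let Xs_homo n m w : (n <= m)%N -> Xs m w <= Xs n w.
Proof. exact: (decreasing_le (Xs_dec ^~ w)). Qed.

Let p V := inf (values V) - l.

Let p_le n V : E V -> p V <= psi (fun w => Xs n w + V w) - l.
Proof. by move=> EV; rewrite lerB//; apply: ge_inf; [exact: values_lb|exists n]. Qed.

Let psi_shift_homo n m V : E V -> (n <= m)%N ->
  psi (fun w => Xs m w + V w) <= psi (fun w => Xs n w + V w).
Proof.
move=> EV nm; apply: psi_inc => [||w]; [exact: U_shift..|].
by rewrite lerD2r Xs_homo.
Qed.

Let p_convex V Y (a : R) : E V -> E Y -> 0 <= a <= 1 ->
  p (fun w => a * V w + (1 - a) * Y w) <= a * p V + (1 - a) * p Y.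
Proof.
move=> EV EY /[dup] a01 /andP[a0 a1].
have -> : a * p V + (1 - a) * p Y =
  (a * inf (values V) + (1 - a) * inf (values Y)) - l by rewrite /p; ring.
have EVY : E (fun w => a * V w + (1 - a) * Y w).
  by apply: dominated_linear => //; exact: dominated_scale.
rewrite lerB//; apply: lb_le_inf_convex => //; [|exact: values_lb..].
move=> _ _ [n _ <-] [m _ <-].
(* The two infima are approached at different indices; as [Xs] decreases, the larger index serves
   for both. *)
apply: (@le_trans _ _ (psi (fun w => Xs (maxn n m) w + (a * V w + (1 - a) * Y w)))).
  by apply: ge_inf; [exact: values_lb|exists (maxn n m)].
have -> : (fun w => Xs (maxn n m) w + (a * V w + (1 - a) * Y w)) =
  (fun w => a * (Xs (maxn n m) w + V w) + (1 - a) * (Xs (maxn n m) w + Y w)).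
  by apply/funext => w; ring.
apply: (le_trans (psi_conv (U_shift _ EV) (U_shift _ EY) a01)).
rewrite lerD// ler_wpM2l// ?subr_ge0// psi_shift_homo//.
  exact: leq_maxl.
exact: leq_maxr.
Qed.

Let values0 : values (fun=> 0) = [set psi (Xs n) | n in [set: nat]].
Proof.
have e n : (fun w => Xs n w + 0) = Xs n by apply/funext => w; rewrite addr0.
by apply/seteqP; split => _ [n _ <-]; exists n; rewrite ?e.
Qed.

Let p0 : p (fun=> 0) = 0.
Proof. by rewrite /p values0 subrr. Qed.

Lemma subgradient_measure : exists mu : {measure set (Borel x0) -> \bar R},
  caZ Z mu /\ forall V n, E V ->
    (pairing V mu <= (psi (fun w => Xs n w + V w) - l)%:E)%E.
Proof.
(* With values in [R^o] the functions form a module over [R], as Hahn-Banach requires. *)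
pose E' : set (Omega x0 -> R^o) := E.
have ED (x y : Omega x0 -> R^o) : E' x -> E' y -> E' (x + y) by exact: dominated_add.
have ES (a : R) (x : Omega x0 -> R^o) : E' x -> E' (a *: x) by exact: dominated_scale.
have [L [L_linear Lp]] := @hahn_banach_convex R (Omega x0 -> R^o) E' ED ES p p_convex p0.
have L_lin (a : R) f g : E f -> E g -> L (fun w => a * f w + g w) = a * L f + L g.
  by move=> Ef Eg; exact: L_linear.
have L_ge0 f : E f -> (forall w, 0 <= f w) -> 0 <= L f.
  move=> Ef f0; have ENf : E (fun w => -1 * f w) by exact: dominated_scale.
  (* Positivity: [- L f = L (- f) <= p (- f)], and monotonicity of [psi] gives [p (- f) <= 0]. *)
  have := Lp _ ENf; rewrite (functional_scale Z1 L_lin)// mulN1r => Lf.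
  rewrite -oppr_le0 (le_trans Lf)// subr_le0 lb_le_inf//.
    by exists (psi (Xs 0%N)); exists 0%N.
  move=> _ [n _ <-]; apply: (@le_trans _ _ (psi (fun w => Xs n w + -1 * f w))).
    by apply: ge_inf; [exact: values_lb|exists n].
  apply: psi_inc => [||w]; [exact: UXs|exact: U_shift|].
  by rewrite mulN1r gerBl.
have L_tail := subgradient_tail (UXs 0%N) (functional_scale Z1 L_lin)
  (fun V EV => le_trans (Lp V EV) (p_le 0%N EV)).
have [mu muL] := daniell_representation Z1 Zc (@open_bump _ _ _ _ x0) L_lin L_ge0
  (tight_functional_continuous Z1 Zc ZK L_lin L_ge0 L_tail).
exists mu; split.
  by rewrite /caZ (muL Z EZ).2 ltry.
move=> V n EV; rewrite /pairing (muL V EV).2 lee_fin.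
by rewrite (le_trans (Lp _ EV))// p_le.
Qed.

(** The sequences [Xs] and [Y] are kept apart to cover two uses: [Xs] constantly [X] with [Y]
    approximating it, and [Xs] equal to [Y]. The subgradient is tested on [V - Y m], where
    [Xs n <= Y m] gives [psi (Xs n + V - Y m) <= psi V]; then [m] tends to infinity. *)
Lemma subgradient_duality (Y : nat -> Omega x0 -> R) :
  (forall m, CZ Z (Y m)) -> (forall m w, Y m.+1 w <= Y m w) ->
  (forall w, Y m w @[m --> \oo] --> X w) ->
  (forall m, exists n, forall w, Xs n w <= Y m w) ->
  exists mu : {measure set (Borel x0) -> \bar R},
    caZ Z mu /\ (l%:E <= pairing X mu - conj_on (CZ Z) psi mu)%E.
Proof.
move=> CY YS YX XsY; have [mu [muZ muP]] := subgradient_measure.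
exists mu; split => //.
have UY m : UZ Z (Y m) by exact: CZ_UZ.
have Xfin := pairing_fin Z1 Zc muZ UX.
suff conjX : (conj_on (CZ Z) psi mu <= pairing X mu - l%:E)%E.
  apply: le_trans (leeB (lexx (pairing X mu)) conjX).
  by rewrite -(fineK Xfin) -(EFinB _ l) -EFinB lee_fin opprB addrC subrK.
apply: ge_ereal_sup => _ [V CV <-].
have UV : UZ Z V by exact: CZ_UZ.
have Vfin := pairing_fin Z1 Zc muZ UV.
have step m : (pairing V mu - (psi V)%:E + l%:E <= pairing (Y m) mu)%E.
  have [n nm] := XsY m.
  have EVY : E (fun w => V w - Y m w).
    by apply: dominated_sub => //; exact/(CZE Z1).
  have := muP _ n EVY; rewrite (pairing_sub Z1 Zc)//.
  have Yfin := pairing_fin Z1 Zc muZ (UY m).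
  rewrite -(fineK Vfin) -(fineK Yfin) -(EFinB _ (psi V)).
  rewrite -(EFinB _ (fine (pairing (Y m) mu))) -EFinD !lee_fin.
  have : psi (fun w => Xs n w + (V w - Y m w)) <= psi V.
    apply: psi_inc => [||w]; [exact: UV|exact: U_shift|].
    by have := nm w; lra.
  lra.
have := cvg_pairing Z1 Zc muZ UX UY YS YX => cY.
have : (pairing V mu - (psi V)%:E + l%:E <= pairing X mu)%E.
  rewrite -(cvg_lim _ cY)//; apply: lime_ge; first exact: cvgP cY.
  by apply: nearW => m; exact: step.
rewrite -(fineK Vfin) -(fineK Xfin) -!(EFinB _ (psi V)) -(EFinB _ l) -EFinD.
by rewrite !lee_fin; lra.
Qed.

End subgradient.

End duality.

Theorem theoremA5 (R : realType) (J T : nat) (HT : (1 <= T)%N)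
  (Om : set (ambient R T J)) (HOm : Om `<=` @pos_first_col R T J)
  (x0 : set_type Om)
  (Z : Omega x0 -> R) (HZ1 : forall w, 1 <= Z w) (HZc : continuous Z)
  (HZK : forall z : R, 0 <= z -> compact [set w | Z w <= z])
  (psi : (Omega x0 -> R) -> R)
  (Hinc : increasing_on (UZ Z) psi) (Hconv : convex_on (UZ Z) psi)
  (Hlim : forall n : nat,
     psi (fun w => n%:R * Num.max (Z w - z) 0) @[z --> +oo] --> psi (fun=> 0)) :
  let i := forall X, UZ Z X ->
      (exists mu : {measure set (Borel x0) -> \bar R}, caZ Z mu /\
          (psi X)%:E = (pairing X mu - conj_on (CZ Z) psi mu)%E) /\
      (forall mu : {measure set (Borel x0) -> \bar R}, caZ Z mu ->
          (pairing X mu - conj_on (CZ Z) psi mu <= (psi X)%:E)%E) in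
  let ii := forall X (Xn : nat -> Omega x0 -> R), UZ Z X ->
      (forall n, CZ Z (Xn n)) ->
      (forall n w, Xn n.+1 w <= Xn n w) ->
      (forall w, Xn n w @[n --> \oo] --> X w) ->
      (forall n, psi (Xn n.+1) <= psi (Xn n)) /\ psi (Xn n) @[n --> \oo] --> psi X in
  let iii := forall X, UZ Z X ->
      (psi X)%:E = ereal_inf [set (psi Y)%:E | Y in [set Y | CZ Z Y /\ forall w, X w <= Y w]] in
  let iv := forall mu : {measure set (Borel x0) -> \bar R}, caZ Z mu ->
      conj_on (CZ Z) psi mu = conj_on (UZ Z) psi mu in
  (i <-> ii) /\ (ii <-> iii) /\ (iii <-> iv).
Proof.
move=> i ii iii iv.
have approx X := @UZ_approx _ _ _ _ _ _ HZ1 HZc X.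
have CU X : CZ Z X -> UZ Z X by exact: CZ_UZ.
have attained X : UZ Z X -> exists mu : {measure set (Borel x0) -> \bar R},
    caZ Z mu /\ ((psi X)%:E <= pairing X mu - conj_on (CZ Z) psi mu)%E.
  move=> UX; have [Y [CY YS YX]] := approx X UX.
  have XY n w : X w <= Y n w := decreasing_cvg_ge (YS ^~ w) (YX w) n.
  have := subgradient_duality HZ1 HZc HZK Hinc Hconv Hlim (fun _ => UX) UX
    (fun _ _ => lexx _) (fun _ _ => lexx _) CY YS YX (fun m => ex_intro _ 0%N (XY m)).
  rewrite (_ : [set _ | _ in _] = [set psi X]) ?inf1//.
  by apply/seteqP; split => [_ [_ _ <-]//|_ ->]; exists 0%N.
have i_iv : i <-> iv.
  split.
  - move=> Hi mu muZ; apply/eqP; rewrite eq_le; apply/andP; split.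
      by apply: le_ereal_sup => _ [X CX <-]; exists X => //; exact: CU.
    apply: ge_ereal_sup => _ [X UX <-].
    by rewrite leeB_swap ?(pairing_fin HZ1 HZc)//; exact: (Hi X UX).2.
  - move=> Hiv X UX.
    have le_psi (mu : {measure set (Borel x0) -> \bar R}) : caZ Z mu ->
        (pairing X mu - conj_on (CZ Z) psi mu <= (psi X)%:E)%E.
      move=> muZ; rewrite Hiv// -leeB_swap ?(pairing_fin HZ1 HZc)//.
      exact: conj_on_ge.
    split=> //; have [mu [muZ Xmu]] := attained X UX; exists mu; split => //.
    by apply/eqP; rewrite eq_le Xmu le_psi.
have i_ii : i -> ii.
  move=> Hi X Xn UX CXn XnS XnX; have UXn n := CU _ (CXn n).
  have dec n : psi (Xn n.+1) <= psi (Xn n) by exact: Hinc.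
  split=> //.
  have XXn n w : X w <= Xn n w := decreasing_cvg_ge (XnS ^~ w) (XnX w) n.
  have lb : lbound [set psi (Xn n) | n in [set: nat]] (psi X).
    by move=> _ [n _ <-]; exact: Hinc.
  have ne : [set psi (Xn n) | n in [set: nat]] !=set0 by exists (psi (Xn 0%N)); exists 0%N.
  (* The values decrease to their infimum, so only [inf <= psi X] needs an argument: (i) is applied
     to the measure obtained for the whole sequence. *)
  rewrite (_ : psi X = inf [set psi (Xn n) | n in [set: nat]]).
    apply: nonincreasing_cvgn; first by apply/nonincreasing_seqP.
    by exists (psi X).
  apply/eqP; rewrite eq_le lb_le_inf//=.
  have [mu [muZ Hmu]] := subgradient_duality HZ1 HZc HZK Hinc Hconv Hlim UXn UX
    XnS XXn CXn XnS XnX (fun m => ex_intro _ m (fun w => lexx _)).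
  by rewrite -lee_fin (le_trans Hmu)//; exact: (Hi X UX).2.
have ii_iii : ii -> iii.
  move=> Hii X UX; apply/eqP; rewrite eq_le; apply/andP; split.
    by apply: le_ereal_inf_tmp => _ [Y [CY XY] <-]; rewrite lee_fin Hinc//; exact: CU.
  have [Y [CY YS YX]] := approx X UX.
  have [_ psiY] := Hii X Y UX CY YS YX.
  apply/lee_addgt0Pr => e e0.
  have [N _ /(_ N (leqnn N))/= YN] := cvgr_lt _ psiY (psi X + e) (ltr_pwDr e0 (lexx _)).
  apply: (@le_trans _ _ (psi (Y N))%:E); last by rewrite -EFinD lee_fin ltW.
  apply: ereal_inf_lbound; exists (Y N) => //; split=> // w.
  exact: decreasing_cvg_ge (YS ^~ w) (YX w) N.
have iii_i : iii -> i.
  move=> Hiii X UX.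
  have le_psi (mu : {measure set (Borel x0) -> \bar R}) : caZ Z mu ->
      (pairing X mu - conj_on (CZ Z) psi mu <= (psi X)%:E)%E.
    move=> muZ; rewrite [leRHS](Hiii X UX); apply: le_ereal_inf_tmp => _ [Y [CY XY] <-].
    (* Each [Y >= X] in [CZ] has a pairing at least that of [X], and the Fenchel inequality holds at
       [Y] by definition of the conjugate. *)
    apply: (@le_trans _ _ (pairing Y mu - conj_on (CZ Z) psi mu)%E).
      by apply: leeB => //; apply: (le_pairing HZ1 HZc) => //; exact: CU.
    by rewrite -leeB_swap ?(pairing_fin HZ1 HZc)//; [exact: conj_on_ge|exact: CU].
  split=> //; have [mu [muZ Xmu]] := attained X UX; exists mu; split => //.
  by apply/eqP; rewrite eq_le Xmu le_psi.
split; [split => //|split; [split => //|]].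
- by move=> /ii_iii/iii_i.
- by move=> /iii_i/i_ii.
- split; first by move=> /iii_i/i_iv.
  by move=> /i_iv/i_ii/ii_iii.
Qed.
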